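(* If $G$ is a connected graph of order $n$ with diameter $d$, then $$m_{D^{L}(G)}[0,dn]\geq d+1.$$
   Context: All graphs are finite, simple and connected. For a connected graph $G$ with vertex set $\{v_1,\dots,v_n\}$, $d_{uv}$ is the length of a shortest path between $u$ and $v$, the diameter is the maximum of the $d_{uv}$, $D(G)=(d_{uv})$ is the distance matrix, $Tr(v)=\sum_{u\in V(G)}d_{uv}$ is the transmission of $v$, and the distance Laplacian matrix is $D^L(G)=\mathrm{diag}(Tr(v_1),\dots,Tr(v_n))-D(G)$. Its eigenvalues (all real) are the distance Laplacian eigenvalues of $G$. For an interval $I\subseteq\mathbb{R}$, $m_{D^L(G)}I$ denotes the number of distance Laplacian eigenvalues of $G$, counted with multiplicity, lying in $I$. *)

(* Defs.v *)
From mathcomp Require Import all_boot all_order all_algebra.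
From mathcomp Require Import reals.
From mathcomp Require Import polyrcf.

Set Implicit Arguments.
Unset Strict Implicit.
Unset Printing Implicit Defensive.

Import Order.TTheory GRing.Theory Num.Theory.

Local Open Scope ring_scope.

Section Graph.
Variables (T : finType) (e : rel T).

Definition simple_graph : Prop := symmetric e /\ irreflexive e.

(* Connected graphs are nonempty. *)
Definition connected_graph : Prop := (0 < #|T|)%N /\ forall x y, connect e x y.

(* [p] lists the vertices after [x], so a [k.-tuple] is a path with k edges. *)
Definition path_of_length (x y : T) (k : nat) : bool :=
  [exists p : k.-tuple T,
    [&& path e x p, last x p == y & uniq (x :: p)]].

(* A path has fewer than #|T| edges, so the bound on k loses nothing; the
   default value #|T| is only taken when y is not reachable from x. *)
Definition gdist (x y : T) : nat :=
  \big[minn/#|T|]_(k < #|T| | path_of_length x y k) k.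

Definition diameter : nat := \max_(x : T) \max_(y : T) gdist x y.

Definition transmission (v : T) : nat := (\sum_(u : T) gdist u v)%N.

End Graph.

Definition distance_mx (R : realType) (n : nat) (e : rel 'I_n) : 'M[R]_n :=
  \matrix_(i, j) (gdist e i j)%:R.

Definition distance_laplacian (R : realType) (n : nat) (e : rel 'I_n) :
    'M[R]_n :=
  diag_mx (\row_i (transmission e i)%:R) - distance_mx R e.

(* [rootsR p] is the duplicate-free list of all the roots of p in R, here with
   p the (nonzero) characteristic polynomial; each one is weighted by its
   multiplicity as a root. *)
Definition eigenvalue_count (R : realType) (n : nat) (A : 'M[R]_n)
    (I : interval R) : nat :=
  (\sum_(a <- rootsR (char_poly A) | a \in I) mup a (char_poly A))%N.

(* Main.v *)
Require Import Defs.
From mathcomp Require Import all_boot all_order all_algebra.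
From mathcomp Require Import reals.
From mathcomp Require Import polyrcf complex ring.

(** All [n] eigenvalues lie in [[0, d * n]]: with [x] an eigenvector for [z],
    [2 z |x|^2 = \sum_(i, j) d_ij |x_i - x_j|^2] lies between [0] and
    [d \sum_(i, j) |x_i - x_j|^2 = 2 d (n |x|^2 - |\sum_i x_i|^2)].  A path has
    fewer than [n] edges, so [n >= d + 1].  Running this argument over the
    complex numbers also shows that all roots of the characteristic polynomial
    are real. *)

Import Order.TTheory GRing.Theory Num.Theory.

Local Open Scope ring_scope.

Section Distance.
Variables (T : finType) (e : rel T).

(** The reversed path, listed after its start [y], is [rev (belast x p)]. *)
Lemma path_of_length_sym x y k :
  symmetric e -> path_of_length e x y k -> path_of_length e y x k.
Proof.
move=> e_sym /existsP [p /and3P [e_p /eqP p_last p_uniq]].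
have size_q : size (rev (belast x p)) == k.
  by rewrite size_rev size_belast size_tuple.
have q_eq : y :: rev (belast x p) = rev (x :: p).
  by rewrite [x :: p]lastI p_last rev_rcons.
apply/existsP; exists (Tuple size_q); apply/and3P; split => /=.
- rewrite -p_last rev_path; rewrite (eq_path (e' := e)) // => u v; exact: e_sym.
- by rewrite -(last_cons y) q_eq rev_cons last_rcons.
- by have := p_uniq; rewrite -rev_uniq -q_eq.
Qed.

Lemma gdist_sym x y : symmetric e -> gdist e x y = gdist e y x.
Proof.
move=> e_sym; rewrite /gdist; apply: eq_bigl => k.
by apply/idP/idP; apply: path_of_length_sym.
Qed.

(** Shortening a walk to distinct vertices gives fewer than [#|T|] edges, an admissible index of the
    minimum, so the default [#|T|] is not its value. *)
Lemma gdist_ltn_card x y : connect e x y -> (gdist e x y < #|T|)%N.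
Proof.
move=> /connectP [p0 e_p0 ->]; case/shortenP: e_p0 => p e_p p_uniq _.
have size_p : (size p < #|T|)%N.
  by have := max_card (mem (x :: p)); rewrite (card_uniqP p_uniq).
apply: (leq_ltn_trans _ size_p); rewrite /gdist -minEnat -leEnat.
apply: (@bigmin_le_cond _ nat 'I_#|T| _ (Ordinal size_p)).
by apply/existsP; exists (in_tuple p); rewrite e_p eqxx p_uniq.
Qed.

Lemma gdist_le_diameter x y : (gdist e x y <= diameter e)%N.
Proof.
rewrite /diameter.
apply: leq_trans (leq_bigmax (F := fun x => \max_y gdist e x y)%N x).
exact: (leq_bigmax (F := gdist e x) y).
Qed.

Lemma diameter_ltn_card : connected_graph e -> (diameter e < #|T|)%N.
Proof.
case=> T_gt0 e_conn; rewrite /diameter -(prednK T_gt0) ltnS.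
apply/bigmax_leqP => x _; apply/bigmax_leqP => y _.
by rewrite -ltnS (prednK T_gt0); apply: gdist_ltn_card.
Qed.

End Distance.

Section WeightedLaplacian.
Variables (C : numClosedFieldType) (n : nat).
Implicit Types (W : 'M[C]_n) (v : 'rV[C]_n).

Lemma laplacian_form W v : (forall i j, W i j = W j i) ->
  \sum_i \sum_j W i j * `|v 0 i - v 0 j| ^+ 2 =
  2 * (\sum_j (\sum_i W i j) * `|v 0 j| ^+ 2
       - \sum_j (\sum_i v 0 i * W i j) * (v 0 j)^*).
Proof.
move=> W_sym.
(* By symmetry of [W], each summand on the left is [A i j + A j i], and the two halves have the same
   double sum. *)
pose A i j := W i j * `|v 0 j| ^+ 2 - v 0 i * W i j * (v 0 j)^*.
have -> : \sum_j (\sum_i W i j) * `|v 0 j| ^+ 2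
       - \sum_j (\sum_i v 0 i * W i j) * (v 0 j)^* = \sum_i \sum_j A i j.
  rewrite exchange_big /= -sumrB; apply: eq_bigr => j _.
  by rewrite !mulr_suml -sumrB.
rewrite mulr_natl mulr2n [X in _ = _ + X]exchange_big -big_split; apply: eq_bigr => i _.
rewrite -big_split; apply: eq_bigr => j _ /=.
by rewrite /A (W_sym j i) !normCK rmorphB /=; ring.
Qed.

Lemma laplacian_eigenvalue W (d z : C) :
  (forall i j, W i j = W j i) -> (forall i j, 0 <= W i j <= d) ->
  eigenvalue (diag_mx (\row_j \sum_i W i j) - W) z -> 0 <= z <= d * n%:R.
Proof.
move=> W_sym W_bound /eigenvalueP [v v_eigen v_neq0].
pose N := \sum_j `|v 0 j| ^+ 2.
have N_gt0 : 0 < N.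
  rewrite lt_def sumr_ge0 ?andbT => [|i _]; last exact: exprn_ge0.
  apply: contraNneq v_neq0 => /eqP N_eq0; apply/eqP/rowP => j; rewrite mxE.
  move: N_eq0; rewrite psumr_eq0 => [/allP/(_ j)|i _]; last exact: exprn_ge0.
  by rewrite mem_index_enum => /(_ isT) /=; rewrite sqrf_eq0 normr_eq0 => /eqP.
have form_z : \sum_i \sum_j W i j * `|v 0 i - v 0 j| ^+ 2 = 2 * (z * N).
  rewrite laplacian_form //; congr (2 * _); rewrite -sumrB /N mulr_sumr.
  (* Coordinate [j] of the eigenvector equation, multiplied by the conjugate of [v 0 j]. *)
  apply: eq_bigr => j _; have := congr1 (fun u : 'rV_n => u 0 j) v_eigen.
  rewrite /= mulmxBr mul_mx_diag !mxE => vj.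
  by rewrite normCK [z * _]mulrA -vj; ring.
have form_ge0 i j : 0 <= `|v 0 i - v 0 j| ^+ 2 by apply: exprn_ge0.
have form_le : \sum_i \sum_j `|v 0 i - v 0 j| ^+ 2 <= 2 * (n%:R * N).
  (* All-ones weights turn the unweighted sum into another instance of [laplacian_form]. *)
  pose J : 'M[C]_n := const_mx 1.
  have -> : \sum_i \sum_j `|v 0 i - v 0 j| ^+ 2
          = \sum_i \sum_j J i j * `|v 0 i - v 0 j| ^+ 2.
    by apply: eq_bigr => i _; apply: eq_bigr => j _; rewrite mxE mul1r.
  rewrite laplacian_form => [|i j]; last by rewrite !mxE.
  rewrite ler_wpM2l // lerBlDr -[leLHS]addr0 lerD //.
    rewrite /N mulr_sumr le_eqVlt; apply/orP; left; apply/eqP.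
    apply: eq_bigr => j _; under eq_bigr do rewrite mxE.
    by rewrite sumr_const card_ord.
  (* The subtracted term is the squared modulus of the sum of the coordinates, hence nonnegative. *)
  under eq_bigr do under eq_bigr do rewrite mxE mulr1.
  by rewrite -mulr_sumr -rmorph_sum -normCK exprn_ge0.
have z_form : 0 <= 2 * (z * N) <= 2 * (d * n%:R * N).
  rewrite -form_z; apply/andP; split.
    apply: sumr_ge0 => i _; apply: sumr_ge0 => j _.
    by case/andP: (W_bound i j) => W_ge0 _; apply: mulr_ge0.
  have d_form : \sum_i \sum_j W i j * `|v 0 i - v 0 j| ^+ 2
             <= d * \sum_i \sum_j `|v 0 i - v 0 j| ^+ 2.
    rewrite mulr_sumr; apply: ler_sum => i _; rewrite mulr_sumr.
    apply: ler_sum => j _; apply: ler_wpM2r => //.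
    by case/andP: (W_bound i j).
  apply: le_trans d_form _; rewrite -mulrA mulrCA; apply: ler_wpM2l => //.
  (* What remains is [0 <= d], read off any diagonal weight; an index exists because [v] is
     nonzero. *)
  have [j _ | v0] := pickP 'I_n; last first.
    by case/eqP: v_neq0; apply/rowP => j; have := v0 j.
  by have /andP[/le_trans] := W_bound j j; apply.
by move: z_form; rewrite pmulr_rge0 ?ler_pM2l // pmulr_lge0 // ler_pM2r.
Qed.

End WeightedLaplacian.

(** The order of [R[i]] only compares numbers with equal imaginary parts, so the bounds force every
    complex root to be real. The factorization over [R[i]] then descends to [R]. *)
Lemma real_roots_split (R : rcfType) (p : {poly R}) (a b : R) : p \is monic ->
  (forall z : R[i], root (map_poly (real_complex R) p) z ->
     real_complex R a <= z <= real_complex R b) ->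
  exists2 s : seq R, p = \prod_(x <- s) ('X - x%:P)
    & {in s, forall x, a <= x <= b}.
Proof.
move=> p_monic p_roots.
have [r p_eq] := closed_field_poly_normal (map_poly (real_complex R) p).
have r_bound z : z \in r -> real_complex R a <= z <= real_complex R b.
  move=> z_r; apply: p_roots; rewrite p_eq rootZ ?root_prod_XsubC //.
  by rewrite lead_coef_eq0 map_poly_eq0 monic_neq0.
have r_real z : z \in r -> real_complex R (complex.Re z) = z.
  move=> /r_bound /andP [az _]; apply/RRe_real.
  by rewrite -(subrK (real_complex R a) z) realD ?complex_real // ger0_real ?subr_ge0.
exists (map (@complex.Re R) r).
  apply: (map_poly_inj (real_complex R)); rewrite p_eq.
  rewrite (monicP _) ?scale1r ?map_monic //.
  rewrite rmorph_prod big_map /= big_seq [RHS]big_seq.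
  by apply: eq_bigr => z z_r; rewrite map_polyXsubC /= r_real.
by move=> _ /mapP [z z_r ->]; rewrite -!lecR r_real //; apply: r_bound.
Qed.

Lemma eigenvalue_count_split (R : realType) n (A : 'M[R]_n) (I : interval R)
    (s : seq R) :
  char_poly A = \prod_(x <- s) ('X - x%:P) -> {in s, forall x, x \in I} ->
  eigenvalue_count A I = n.
Proof.
move=> A_split s_I; have := size_char_poly A.
rewrite A_split size_prod_XsubC => -[size_s]; rewrite -[RHS]size_s /eigenvalue_count A_split.
set p := \prod_(x <- s) _.
have p_neq0 : p != 0 by apply: monic_neq0; apply: monic_prod_XsubC.
(* Double counting: a multiplicity is a number of occurrences in [s], and each entry of [s] matches
   exactly one element of the duplicate-free root list. *)
under eq_bigr do rewrite mu_prod_XsubC -sum1_count big_mkcond /=.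
rewrite exchange_big /= -sum1_size big_seq [RHS]big_seq; apply: eq_bigr => x x_s.
rewrite -big_filter -big_mkcond /= sum1_count.
under eq_count do rewrite eq_sym.
rewrite count_uniq_mem ?filter_uniq ?uniq_roots // mem_filter s_I //=.
by rewrite -roots_on_rootsR // root_prod_XsubC x_s.
Qed.

Theorem theorem3p11 (R : realType) (n d : nat) (e : rel 'I_n)
    (hG : simple_graph e) (hconn : connected_graph e) (hd : diameter e = d) :
  (d + 1 <= eigenvalue_count (distance_laplacian R e)
              `[0, d%:R * n%:R]%R)%N.
Proof.
have [e_sym _] := hG.
have [||s A_split s_bound] :=
    @real_roots_split R (char_poly (distance_laplacian R e)) 0 (d%:R * n%:R).
- exact: char_poly_monic.
- move=> z; rewrite map_char_poly -eigenvalue_root_char.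
  (* Over [R[i]] the distance Laplacian is the Laplacian with weights [W]: transmissions are the
     column sums of [W]. *)
  pose W : 'M[R[i]]_n := \matrix_(i, j) (gdist e i j)%:R.
  have -> : map_mx (real_complex R) (distance_laplacian R e) =
            diag_mx (\row_j \sum_i W i j) - W.
    rewrite map_mxB map_diag_mx; congr (diag_mx _ - _); last first.
      by apply/matrixP => i j; rewrite !mxE [LHS]rmorph_nat.
    apply/rowP => j; rewrite !mxE [LHS]rmorph_nat natr_sum.
    by apply: eq_bigr => i _; rewrite mxE.
  rewrite rmorph0 rmorphM !rmorph_nat; apply: laplacian_eigenvalue => i j.
    by rewrite !mxE gdist_sym.
  by rewrite mxE ler0n ler_nat -hd gdist_le_diameter.
(* The count equals [n], which leaves [diameter e < n]. *)
rewrite (@eigenvalue_count_split R n _ _ s) // addn1 -hd.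
by have := diameter_ltn_card _ _ hconn; rewrite card_ord.
Qed.
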